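(* Let $m\ge 2$. Every local $\frac12$-derivation of the complex Lie algebra $\mathfrak{L}^m=\mathfrak{sl}_2\ltimes\mathfrak{r}$ is a $\frac12$-derivation.
   Context: All algebras are over $\mathbb{C}$. A linear map $D:\mathfrak{L}\to\mathfrak{L}$ on a Lie algebra is a $\frac12$-derivation if $D[x,y]=\frac12\big([D(x),y]+[x,D(y)]\big)$ for all $x,y\in\mathfrak{L}$. A linear map $\Delta:\mathfrak{L}\to\mathfrak{L}$ is a local $\frac12$-derivation if for every $x\in\mathfrak{L}$ there is a $\frac12$-derivation $D_x$ (depending on $x$) with $\Delta(x)=D_x(x)$. For $m\ge 2$, $\mathfrak{L}^m=\mathfrak{sl}_2\ltimes\mathfrak{r}$ is the Lie algebra with basis $\{e,f,h,x_0,x_1,\dots,x_m\}$, where $\mathfrak{r}=\operatorname{span}\{x_0,\dots,x_m\}$ is an abelian ideal which is the $(m+1)$-dimensional irreducible $\mathfrak{sl}_2$-module, and brackets $[e,f]=h$, $[h,e]=2e$, $[f,h]=2f$, $[x_k,h]=(2k-m)x_k$ for $0\le k\le m$, $[x_k,f]=x_{k+1}$ for $0\le k\le m-1$, $[x_k,e]=k(m+1-k)x_{k-1}$ for $1\le k\le m$; brackets of basis elements not obtained from these by antisymmetry are zero. *)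

(* Defs.v *)
From HB Require Import structures.
From mathcomp Require Import all_boot all_order all_algebra.
From mathcomp Require Import ring.

Set Implicit Arguments.
Unset Strict Implicit.
Unset Printing Implicit Defensive.

Import GRing.Theory.
Local Open Scope ring_scope.

HB.mixin Record isLieAlgebra (K : comNzRingType) (L : Type)
    of GRing.Lmodule K L := {
  lie : L -> L -> L;
  lie_linearl : forall (a : K) (u v w : L),
    lie (a *: u + v) w = a *: lie u w + lie v w;
  lie_linearr : forall (a : K) (u v w : L),
    lie w (a *: u + v) = a *: lie w u + lie w v;
  lie_alt : forall u : L, lie u u = 0;
  lie_jacobi : forall u v w : L,
    lie u (lie v w) + lie v (lie w u) + lie w (lie u v) = 0
}.

#[short(type="lieAlgType")]
HB.structure Definition LieAlgebra (K : comNzRingType) :=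
  { L of isLieAlgebra K L & GRing.Lmodule K L }.

Definition is_half_derivation (K : fieldType) (L : lieAlgType K)
    (D : {linear L -> L}) : Prop :=
  forall u v : L, D (lie u v) = 2%:R^-1 *: (lie (D u) v + lie u (D v)).

Definition is_local_half_derivation (K : fieldType) (L : lieAlgType K)
    (Delta : {linear L -> L}) : Prop :=
  forall u : L, exists D : {linear L -> L},
    is_half_derivation D /\ Delta u = D u.

(* An element of [sl2r K m] is a pair (s, v): the coordinates of s are taken
   along e, f, h (in this order), those of v along x_0, ..., x_m. *)
Definition sl2r (K : comNzRingType) (m : nat) : Type :=
  ('rV[K]_3 * 'rV[K]_m.+1)%type.

HB.instance Definition _ (K : comNzRingType) (m : nat) :=
  GRing.Lmodule.on (sl2r K m).

Definition i_e : 'I_3 := @Ordinal 3 0 isT.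
Definition i_f : 'I_3 := @Ordinal 3 1 isT.
Definition i_h : 'I_3 := @Ordinal 3 2 isT.

Section Bracket.
Variables (K : comNzRingType) (m : nat).
Implicit Types (s t : 'rV[K]_3) (v w : 'rV[K]_m.+1) (a b : sl2r K m).

(* [e, f] = h, [h, e] = 2 e, [f, h] = 2 f, extended bilinearly *)
Definition sl2_bracket s t : 'rV[K]_3 :=
  (2%:R * (s 0 i_h * t 0 i_e - s 0 i_e * t 0 i_h)) *: delta_mx 0 i_e
  + (2%:R * (s 0 i_f * t 0 i_h - s 0 i_h * t 0 i_f)) *: delta_mx 0 i_f
  + (s 0 i_e * t 0 i_f - s 0 i_f * t 0 i_e) *: delta_mx 0 i_h.

(* x_k, with the convention x_k = 0 for k > m *)
Definition rx (k : nat) : 'rV[K]_m.+1 := \row_j (nat_of_ord j == k)%:R.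

(* Row k is the bracket of x_k with s. The out-of-range terms x_{m+1} and x_{-1}
   vanish: the first is 0 by the convention of [rx], the second (where [k.-1] is
   truncated) has coefficient 0. *)
Definition sl2_act s : 'M[K]_m.+1 :=
  \matrix_(k < m.+1)
    (s 0 i_e *: ((k * (m.+1 - k))%:R *: rx k.-1)
     + s 0 i_f *: rx k.+1
     + s 0 i_h *: (((2 * k)%:R - m%:R) *: rx k)).

Definition sl2r_bracket a b : sl2r K m :=
  (sl2_bracket a.1 b.1, a.2 *m sl2_act b.1 - b.2 *m sl2_act a.1).

Lemma rx_gt k : (m < k)%N -> rx k = 0.
Proof.
move=> mk; apply/rowP=> j; rewrite !mxE; case: eqP => // E.
by have := ltn_ord j; rewrite E ltnNge mk.
Qed.

Lemma rx_act k s : rx k *m sl2_act s =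
  s 0 i_e *: ((k * (m.+1 - k))%:R *: rx k.-1)
  + s 0 i_f *: rx k.+1
  + s 0 i_h *: (((2 * k)%:R - m%:R) *: rx k).
Proof.
case: (ltnP k m.+1) => km; last first.
  rewrite [rx k]rx_gt // (rx_gt (k := k.+1)) 1?ltnW // mul0mx.
  by rewrite (eqP km) muln0 !(scale0r, scaler0, addr0).
have -> : rx k = delta_mx 0 (Ordinal km).
  by apply/rowP=> j; rewrite !mxE eqxx /=.
by rewrite -rowE rowK; congr (_ + _ + _ *: (_ *: _));
  apply/rowP=> j; rewrite !mxE.
Qed.

Lemma sl2_bracket_coef s t :
  [/\ sl2_bracket s t 0 i_e = 2%:R * (s 0 i_h * t 0 i_e - s 0 i_e * t 0 i_h),
      sl2_bracket s t 0 i_f = 2%:R * (s 0 i_f * t 0 i_h - s 0 i_h * t 0 i_f)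
    & sl2_bracket s t 0 i_h = s 0 i_e * t 0 i_f - s 0 i_f * t 0 i_e].
Proof.
by split; rewrite !mxE -!val_eqE /= !(mulr0, mulr1, addr0, add0r).
Qed.

Lemma sl2_rowP s t : s 0 i_e = t 0 i_e -> s 0 i_f = t 0 i_f ->
  s 0 i_h = t 0 i_h -> s = t.
Proof.
move=> He Hf Hh; apply/rowP=> -[[|[|[|n]]] p] //.
- by rewrite (_ : Ordinal p = i_e) //; apply: val_inj.
- by rewrite (_ : Ordinal p = i_f) //; apply: val_inj.
- by rewrite (_ : Ordinal p = i_h) //; apply: val_inj.
Qed.

Lemma sl2_act_linear c s t : sl2_act (c *: s + t) = c *: sl2_act s + sl2_act t.
Proof. by apply/matrixP=> i j; rewrite !mxE; ring. Qed.

Lemma sl2_act_bracket s t :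
  sl2_act (sl2_bracket s t) =
  sl2_act s *m sl2_act t - sl2_act t *m sl2_act s.
Proof.
have [He Hf Hh] := sl2_bracket_coef s t.
apply/row_matrixP=> i.
have E (A : 'M[K]_m.+1) : row i A = rx i *m A.
  rewrite rowE; congr (_ *m _); apply/rowP=> j.
  by rewrite !mxE eqxx.
rewrite !E mulmxBr !mulmxA !rx_act He Hf Hh.
rewrite !mulmxDl -!scalemxAl !rx_act /=.
have := ltn_ord i; move: (nat_of_ord i) => k; rewrite ltnS => km {E}.
have [d Ed] : exists d, m = (k + d)%N by exists (m - k)%N; rewrite subnKC.
apply/rowP=> j; rewrite !mxE.
have -> : (m.+1 - k = d.+1)%N by rewrite Ed -addnS addKn.
have -> : (m.+1 - k.+1 = d)%N by rewrite Ed subSS addKn.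
have -> : m%:R = k%:R + d%:R :> K by rewrite Ed natrD.
rewrite !natrM; case: k km Ed => [|k] km Ed /=.
  by rewrite -!natr1; ring.
have -> : (m.+1 - k = d.+2)%N by rewrite Ed addSnnS -addnS addKn.
by rewrite -!natr1; ring.
Qed.

Fact sl2r_linearl (c : K) a b (d : sl2r K m) :
  sl2r_bracket (c *: a + b) d = c *: sl2r_bracket a d + sl2r_bracket b d.
Proof.
congr pair => /=.
  by apply/rowP=> j; rewrite !mxE; ring.
rewrite sl2_act_linear mulmxDl mulmxDr -scalemxAl -scalemxAr scalerBr.
by rewrite opprD addrACA.
Qed.

Fact sl2r_linearr (c : K) a b (d : sl2r K m) :
  sl2r_bracket d (c *: a + b) = c *: sl2r_bracket d a + sl2r_bracket d b.
Proof.
congr pair => /=.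
  by apply/rowP=> j; rewrite !mxE; ring.
rewrite sl2_act_linear mulmxDl mulmxDr -scalemxAl -scalemxAr scalerBr.
by rewrite opprD addrACA.
Qed.

Fact sl2r_alt a : sl2r_bracket a a = 0.
Proof.
congr pair => /=; last by rewrite subrr.
by apply/rowP=> j; rewrite !mxE; ring.
Qed.

Lemma sl2_jacobi s t (u : 'rV[K]_3) :
  sl2_bracket s (sl2_bracket t u) + sl2_bracket t (sl2_bracket u s)
  + sl2_bracket u (sl2_bracket s t) = 0.
Proof.
have D (x y : 'rV[K]_3) i : (x + y) 0 i = x 0 i + y 0 i by rewrite mxE.
have Z i : (0 : 'rV[K]_3) 0 i = 0 by rewrite mxE.
have B x y := sl2_bracket_coef x y.
have [H1 H2 H3] := B t u; have [H4 H5 H6] := B u s; have [H7 H8 H9] := B s t.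
have [A1 A2 A3] := B s (sl2_bracket t u).
have [A4 A5 A6] := B t (sl2_bracket u s).
have [A7 A8 A9] := B u (sl2_bracket s t).
apply: sl2_rowP; rewrite 2!D Z.
- by rewrite A1 A4 A7 H1 H3 H4 H6 H7 H9; ring.
- by rewrite A2 A5 A8 H2 H3 H5 H6 H8 H9; ring.
- by rewrite A3 A6 A9 H1 H2 H4 H5 H7 H8; ring.
Qed.

Fact sl2r_jacobi a b (d : sl2r K m) :
  sl2r_bracket a (sl2r_bracket b d) + sl2r_bracket b (sl2r_bracket d a)
  + sl2r_bracket d (sl2r_bracket a b) = 0.
Proof.
congr pair => /=; first exact: sl2_jacobi.
rewrite !sl2_act_bracket !mulmxBr !mulmxBl !mulmxA.
by apply/rowP=> j; rewrite !(mxE _ _ 0 j); ring.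
Qed.

HB.instance Definition _ := isLieAlgebra.Build K (sl2r K m)
  sl2r_linearl sl2r_linearr sl2r_alt sl2r_jacobi.

Definition Le : sl2r K m := (delta_mx 0 i_e, 0).
Definition Lf : sl2r K m := (delta_mx 0 i_f, 0).
Definition Lh : sl2r K m := (delta_mx 0 i_h, 0).
Definition Lx (k : nat) : sl2r K m := (0, rx k).

Lemma sl2r_basis a :
  a = a.1 0 i_e *: Le + a.1 0 i_f *: Lf + a.1 0 i_h *: Lh
      + \sum_(k < m.+1) a.2 0 k *: Lx k.
Proof.
have S1 : (\sum_(k < m.+1) a.2 0 k *: Lx k).1 = 0.
  by elim/big_ind: _ => //= [x y -> ->|k _]; rewrite ?addr0 ?scaler0.
have S2 : (\sum_(k < m.+1) a.2 0 k *: Lx k).2 = a.2.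
  rewrite [RHS]row_sum_delta.
  apply: (big_ind2 (fun (x : sl2r K m) y => x.2 = y)) => //= [x1 x2 y1 y2 <- <- //|k _].
  by congr (_ *: _); apply/rowP=> j; rewrite !mxE eqxx.
rewrite [LHS]surjective_pairing; congr pair => /=; last first.
  by rewrite S2 !scaler0 !add0r.
rewrite S1 addr0; apply: sl2_rowP;
by rewrite !mxE -!val_eqE /= !(mulr0, mulr1, addr0, add0r).
Qed.

Fact delta3 : ((delta_mx 0 i_e : 'rV[K]_3) 0 i_e = 1) *
  ((delta_mx 0 i_e : 'rV[K]_3) 0 i_f = 0) * ((delta_mx 0 i_e : 'rV[K]_3) 0 i_h = 0) *
  ((delta_mx 0 i_f : 'rV[K]_3) 0 i_e = 0) *
  ((delta_mx 0 i_f : 'rV[K]_3) 0 i_f = 1) * ((delta_mx 0 i_f : 'rV[K]_3) 0 i_h = 0) *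
  ((delta_mx 0 i_h : 'rV[K]_3) 0 i_e = 0) *
  ((delta_mx 0 i_h : 'rV[K]_3) 0 i_f = 0) * ((delta_mx 0 i_h : 'rV[K]_3) 0 i_h = 1).
Proof. by do ![split]; rewrite mxE. Qed.

Let simp := (mulr0, mulr1, mul0r, mul1r, subr0, sub0r, scale0r, scale1r,
  scaler0, addr0, add0r, mul0mx, oppr0).

Fact br_sl2 s t (c : K) i : sl2_bracket s t = c *: delta_mx 0 i ->
  lie ((s, 0) : sl2r K m) ((t, 0) : sl2r K m) = c *: ((delta_mx 0 i, 0) : sl2r K m).
Proof. by move=> H; congr pair; rewrite //= ?mul0mx ?subr0 ?scaler0. Qed.

Lemma lie_ef : lie Le Lf = Lh.
Proof. by rewrite -[RHS]scale1r; apply: br_sl2; rewrite /sl2_bracket !delta3 !simp. Qed.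

Lemma lie_he : lie Lh Le = 2%:R *: Le.
Proof. by apply: br_sl2; rewrite /sl2_bracket !delta3 !simp. Qed.

Lemma lie_fh : lie Lf Lh = 2%:R *: Lf.
Proof. by apply: br_sl2; rewrite /sl2_bracket !delta3 !simp. Qed.

Fact br_x k s w : rx k *m sl2_act s = w ->
  lie (Lx k) ((s, 0) : sl2r K m) = ((0, w) : sl2r K m).
Proof.
move=> H; congr pair; rewrite /= ?H ?mul0mx ?subr0 //.
by rewrite /sl2_bracket !(mxE, simp).
Qed.

Lemma lie_xh (k : nat) :
  lie (Lx k) Lh = ((2 * k)%:R - m%:R) *: Lx k.
Proof.
rewrite (br_x (rx_act _ _)) !delta3 !simp.
by congr pair; rewrite scaler0.
Qed.

Lemma lie_xf (k : nat) : lie (Lx k) Lf = Lx k.+1.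
Proof. by rewrite (br_x (rx_act _ _)) !delta3 !simp. Qed.

Lemma lie_xe (k : nat) : lie (Lx k) Le = (k * (m.+1 - k))%:R *: Lx k.-1.
Proof.
rewrite (br_x (rx_act _ _)) !delta3 !simp.
by congr pair; rewrite scaler0.
Qed.

Lemma lie_xx (k l : nat) : lie (Lx k) (Lx l) = 0.
Proof.
have A0 : sl2_act 0 = 0 by apply/matrixP=> i j; rewrite !mxE !simp.
congr pair; rewrite /= ?A0 ?mulmx0 ?subr0 //.
by rewrite /sl2_bracket !(mxE, simp).
Qed.

End Bracket.

(* Main.v *)
Require Import Defs.
From mathcomp Require Import all_boot all_order all_algebra.
From mathcomp Require Import reals complex.
From mathcomp Require Import ring zify.

Set Implicit Arguments.
Unset Strict Implicit.
Unset Printing Implicit Defensive.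

Import GRing.Theory Num.Theory.
Local Open Scope ring_scope.

(** A half-derivation D is determined by very little. On the quotient sl2 it is
    a scalar c, by a direct computation ([half_derivation_sl2_scalar]). On the
    radical it is the same scalar ([half_derivation_Lx]): the defect D - c
    satisfies 2 (D - c) [x, s] = [(D - c) x, s] for x in the radical, so
    it doubles the weights of h; the image of the extremal vector x_0 would have
    a weight that does not occur, hence D x_0 = c x_0, and bracketing with f
    propagates this to all the x_k. What remains is the component of D from sl2
    to the radical. The values of D on [h, e], [f, h] and [e, f] give a linear
    system whose elimination is governed by the Casimir element
    ([half_derivation_rcoord_casimir]): the component vanishes unless m = 2, and
    for m = 2 it is a multiple of the isomorphism from the adjoint module to the
    radical, e to x_0, h to x_1, f to - x_2 / 2. In all cases D acts on the
    basis like multiplication by a dual number c + mu t, where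
    sl2 + radical is read as sl2 [t] / t ^ 2 ([half_derivation_shape]).

    Let now Delta be a local half-derivation. Subtracting a half-derivation
    that agrees with Delta at h gives a linear map E with E h = 0, which at every
    vector is still given by some dual number depending on the vector. For a
    basis vector u, comparing E (h + u) with E u shows that the dual number used
    at h + u is zero, or at least that its scalar part is, and this forces
    E u = 0. The nilpotent part links h to x_1, which makes this comparison
    inconclusive for x_1; e, now known to satisfy E e = 0, is used instead of h
    for the x_k with k positive. So E = 0, and Delta is the
    half-derivation that was subtracted. *)

(** * Coordinates and the bracket *)

Section Coordinates.
Variables (K : comNzRingType) (m : nat).
Implicit Types (u w : sl2r K m) (v : 'rV[K]_m.+1) (j k : nat).

Lemma sl2_bracketE (s t : 'rV[K]_3) :
  (sl2_bracket s t 0 i_e = 2%:R * (s 0 i_h * t 0 i_e - s 0 i_e * t 0 i_h))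
  * (sl2_bracket s t 0 i_f = 2%:R * (s 0 i_f * t 0 i_h - s 0 i_h * t 0 i_f))
  * (sl2_bracket s t 0 i_h = s 0 i_e * t 0 i_f - s 0 i_f * t 0 i_e).
Proof. by have [-> -> ->] := sl2_bracket_coef s t. Qed.

(** Reading the coordinates off a polynomial makes them total in [j], with the
    value zero beyond x_m, so that shifted indices need no side condition. *)
Definition rcoord u j : K := (rVpoly u.2)`_j.

(** The coordinate of index [j - 1], with a zero below x_0: bracketing with f
    shifts the coordinates up by one. *)
Definition rcoord_pred u j : K := if j is i.+1 then rcoord u i else 0.

Lemma rcoordD u w j : rcoord (u + w) j = rcoord u j + rcoord w j.
Proof. by rewrite /rcoord linearD coefD. Qed.

Lemma rcoordZ c u j : rcoord (c *: u) j = c * rcoord u j.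
Proof. by rewrite /rcoord linearZ coefZ. Qed.

Lemma rcoord_gt u j : (m < j)%N -> rcoord u j = 0.
Proof. by move=> mj; rewrite /rcoord coef_rVpoly insubN // -leqNgt. Qed.

Lemma rcoord_sl2 (s : 'rV[K]_3) j : rcoord (s, 0) j = 0.
Proof. by rewrite /rcoord linear0 coef0. Qed.

Lemma rcoord_pred_sl2 (s : 'rV[K]_3) j : rcoord_pred (s, 0) j = 0.
Proof. by case: j => //= j; rewrite rcoord_sl2. Qed.

Lemma rcoord_Lx k j : (k <= m)%N -> rcoord (Lx K m k) j = (j == k)%:R.
Proof.
move=> km; case: (ltnP m j) => [mj | jm].
  by rewrite rcoord_gt //; case: eqP mj => // ->; rewrite ltnNge km.
by rewrite /rcoord (coef_rVpoly_ord _ (Ordinal (jm : (j < m.+1)%N))) mxE.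
Qed.

Lemma sl2coordD u w i : (u + w).1 0 i = u.1 0 i + w.1 0 i.
Proof. by rewrite mxE. Qed.

Lemma sl2coordZ c u i : (c *: u).1 0 i = c * u.1 0 i.
Proof. by rewrite mxE. Qed.

Lemma sl2coord_Lx k i : (Lx K m k).1 0 i = 0.
Proof. by rewrite mxE. Qed.

Lemma sl2coord_basis :
  ((Le K m).1 0 i_e = 1) * ((Le K m).1 0 i_f = 0) * ((Le K m).1 0 i_h = 0)
  * ((Lf K m).1 0 i_e = 0) * ((Lf K m).1 0 i_f = 1) * ((Lf K m).1 0 i_h = 0)
  * ((Lh K m).1 0 i_e = 0) * ((Lh K m).1 0 i_f = 0) * ((Lh K m).1 0 i_h = 1).
Proof. by rewrite !delta3. Qed.

Lemma sl2r_eqP u w :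
  u.1 0 i_e = w.1 0 i_e -> u.1 0 i_f = w.1 0 i_f -> u.1 0 i_h = w.1 0 i_h ->
  (forall j, (j <= m)%N -> rcoord u j = rcoord w j) -> u = w.
Proof.
case: u w => [s v] [t v'] /= He Hf Hh Hr; congr pair; first exact: sl2_rowP.
apply/rowP=> j; have := Hr j; rewrite -ltnS ltn_ord => /(_ isT).
by rewrite /rcoord !coef_rVpoly_ord.
Qed.

Lemma rcoord_act v (s : 'rV[K]_3) j : (j <= m)%N ->
  rcoord (0, v *m sl2_act m s) j =
    s 0 i_e * (j.+1%:R * (m%:R - j%:R) * rcoord (0, v) j.+1)
    + s 0 i_f * rcoord_pred (0, v) j
    + s 0 i_h * (((2 * j)%:R - m%:R) * rcoord (0, v) j).
Proof.
move=> jm; rewrite {1}/rcoord (coef_rVpoly_ord _ (Ordinal (jm : (j < m.+1)%N))).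
(* Each of the three bracket rules sends x_k to a multiple of one x_i, so the
   x_i-coordinate of the result collects a single term of the sum over k. *)
have pick i (F : nat -> K) :
    \sum_(k < m.+1) v 0 k * F k * (k == i :> nat)%:R = rcoord (0, v) i * F i.
  case: (ltnP m i) => [mi | im].
    rewrite rcoord_gt // mul0r big1 // => k _.
    by rewrite ltn_eqF ?mulr0 // (leq_ltn_trans _ mi) // -ltnS.
  rewrite (bigD1 (Ordinal (im : (i < m.+1)%N))) //= eqxx mulr1.
  rewrite big1 ?addr0 => [|k /negPf]; last first.
    by rewrite -val_eqE /= => ->; rewrite mulr0.
  by rewrite /rcoord (coef_rVpoly_ord _ (Ordinal (im : (i < m.+1)%N))).
have -> : j.+1%:R * (m%:R - j%:R) * rcoord (0, v) j.+1
    = \sum_(k < m.+1) v 0 k * (k * (m.+1 - k))%:R * (k == j.+1 :> nat)%:R.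
  by rewrite (pick _ (fun k => (k * (m.+1 - k))%:R)) subSS natrM natrB // mulrC.
have -> : rcoord_pred (0, v) j
    = \sum_(k < m.+1) v 0 k * 1 * (k.+1 == j :> nat)%:R.
  case: (j) => [|i] /=; last by rewrite (pick i (fun=> 1)) mulr1.
  by rewrite big1 // => k _; rewrite mulr0.
have -> : ((2 * j)%:R - m%:R) * rcoord (0, v) j
    = \sum_(k < m.+1) v 0 k * ((2 * k)%:R - m%:R) * (k == j :> nat)%:R.
  by rewrite (pick _ (fun k => (2 * k)%:R - m%:R)) mulrC.
rewrite mxE !mulr_sumr -!big_split /=; apply: eq_bigr => k _.
rewrite !mxE /= [j == k]eq_sym [j == k.+1]eq_sym.
have -> : (k * (m.+1 - k))%:R * (j == k.-1)%:R
    = (k * (m.+1 - k))%:R * (k == j.+1 :> nat)%:R :> K.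
  case: (k : nat) => [|i] /=; first by rewrite mul0n !mul0r.
  by rewrite eqSS [j == i]eq_sym.
by ring.
Qed.

Lemma rcoord_lie u w j : (j <= m)%N ->
  rcoord (lie u w) j =
    (w.1 0 i_e * (j.+1%:R * (m%:R - j%:R) * rcoord u j.+1)
     + w.1 0 i_f * rcoord_pred u j
     + w.1 0 i_h * (((2 * j)%:R - m%:R) * rcoord u j))
  - (u.1 0 i_e * (j.+1%:R * (m%:R - j%:R) * rcoord w j.+1)
     + u.1 0 i_f * rcoord_pred w j
     + u.1 0 i_h * (((2 * j)%:R - m%:R) * rcoord w j)).
Proof.
move=> jm; have := rcoord_act u.2 w.1 jm; have := rcoord_act w.2 u.1 jm.
rewrite /rcoord_pred /rcoord /= => Hw Hu.
by rewrite linearB coefB Hw Hu.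
Qed.

End Coordinates.

(** * The equations of a half-derivation *)

Section HalfDerivations.
Variables (K : fieldType) (m : nat).
Hypotheses (charK : [pchar K] =i pred0) (m_ge2 : (2 <= m)%N).
Implicit Types (u w : sl2r K m) (D : {linear sl2r K m -> sl2r K m}).

Let e : sl2r K m := Le K m.
Let f : sl2r K m := Lf K m.
Let h : sl2r K m := Lh K m.
Let x : nat -> sl2r K m := Lx K m.

Lemma natK_neq0 n : n.+1%:R != 0 :> K.
Proof. by rewrite ((pcharf0P K).1 charK). Qed.

Lemma natK_mul_eq0 n (c : K) : n.+1%:R * c = 0 -> c = 0.
Proof. by move/eqP; rewrite mulf_eq0 (negPf (natK_neq0 n)) => /eqP. Qed.

Lemma natK_eq p q : (p%:R == q%:R :> K) = (p == q).
Proof.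
wlog pq : p q / (p <= q)%N => [th|].
  case/orP: (leq_total p q) => /th //.
  by rewrite eq_sym => ->; rewrite eq_sym.
rewrite -subr_eq0 -oppr_eq0 opprB -natrB // ((pcharf0P K).1 charK).
by rewrite subn_eq0 eqn_leq pq.
Qed.

Lemma natK_sub_mul_eq0 p q (c : K) : p != q -> (p%:R - q%:R) * c = 0 -> c = 0.
Proof.
by move=> pq /eqP; rewrite mulf_eq0 subr_eq0 natK_eq (negPf pq) => /eqP.
Qed.

Lemma half_derivation_double D u w : is_half_derivation D ->
  2%:R *: D (lie u w) = lie (D u) w + lie u (D w).
Proof. by move=> hD; rewrite hD scalerA divff ?scale1r ?natK_neq0. Qed.

Lemma half_derivation_he D : is_half_derivation D ->
  4%:R *: D e = lie (D h) e + lie h (D e).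
Proof.
by move=> hD; rewrite -half_derivation_double // lie_he linearZ scalerA -natrM.
Qed.

Lemma half_derivation_fh D : is_half_derivation D ->
  4%:R *: D f = lie (D f) h + lie f (D h).
Proof.
by move=> hD; rewrite -half_derivation_double // lie_fh linearZ scalerA -natrM.
Qed.

Lemma half_derivation_ef D : is_half_derivation D ->
  2%:R *: D h = lie (D e) f + lie e (D f).
Proof. by move=> hD; rewrite -half_derivation_double // lie_ef. Qed.

Let simp := (delta3, rcoord_sl2, rcoord_pred_sl2, mul0r, mulr0, mul1r, mulr1,
  add0r, addr0, sub0r, subr0, oppr0).

Lemma half_derivation_rcoord_e D j : is_half_derivation D -> (j <= m)%N ->
  4%:R * rcoord (D e) j = j.+1%:R * (m%:R - j%:R) * rcoord (D h) j.+1
    - ((2 * j)%:R - m%:R) * rcoord (D e) j.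
Proof.
move=> hD jm; rewrite -rcoordZ half_derivation_he // rcoordD !rcoord_lie //=.
by rewrite !simp.
Qed.

Lemma half_derivation_rcoord_f D j : is_half_derivation D -> (j <= m)%N ->
  4%:R * rcoord (D f) j =
    ((2 * j)%:R - m%:R) * rcoord (D f) j - rcoord_pred (D h) j.
Proof.
move=> hD jm; rewrite -rcoordZ half_derivation_fh // rcoordD !rcoord_lie //=.
by rewrite !simp.
Qed.

Lemma half_derivation_rcoord_h D j : is_half_derivation D -> (j <= m)%N ->
  2%:R * rcoord (D h) j =
    rcoord_pred (D e) j - j.+1%:R * (m%:R - j%:R) * rcoord (D f) j.+1.
Proof.
move=> hD jm; rewrite -rcoordZ half_derivation_ef // rcoordD !rcoord_lie //=.
by rewrite !simp.
Qed.

(** * The component from sl2 to sl2 *)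

Lemma half_derivation_sl2_scalar D : is_half_derivation D ->
  let c := (D h).1 0 i_h in
  [/\ (D e).1 = c *: delta_mx 0 i_e, (D f).1 = c *: delta_mx 0 i_f
    & (D h).1 = c *: delta_mx 0 i_h].
Proof.
move=> hD c.
have coef n u v w i : n%:R *: u = v + w ->
    n%:R * u.1 0 i = v.1 0 i + w.1 0 i :> K.
  by move/(congr1 (fun y : sl2r K m => y.1 0 i)); rewrite !mxE.
have ee : 4%:R * (D e).1 0 i_e = 2%:R * c + 2%:R * (D e).1 0 i_e.
  rewrite (coef _ _ _ _ _ (half_derivation_he hD)) /=.
  by rewrite !sl2_bracketE !simp.
have ef : 4%:R * (D e).1 0 i_f = - (2%:R * (D e).1 0 i_f).
  rewrite (coef _ _ _ _ _ (half_derivation_he hD)) /=.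
  by rewrite !sl2_bracketE !simp mulrN.
have eh : 4%:R * (D e).1 0 i_h = - (D h).1 0 i_f.
  rewrite (coef _ _ _ _ _ (half_derivation_he hD)) /=.
  by rewrite !sl2_bracketE !simp.
have fe : 4%:R * (D f).1 0 i_e = - (2%:R * (D f).1 0 i_e).
  rewrite (coef _ _ _ _ _ (half_derivation_fh hD)) /=.
  by rewrite !sl2_bracketE !simp mulrN.
have ff : 4%:R * (D f).1 0 i_f = 2%:R * (D f).1 0 i_f + 2%:R * c.
  rewrite (coef _ _ _ _ _ (half_derivation_fh hD)) /=.
  by rewrite !sl2_bracketE !simp.
have fh : 4%:R * (D f).1 0 i_h = - (D h).1 0 i_e.
  rewrite (coef _ _ _ _ _ (half_derivation_fh hD)) /=.
  by rewrite !sl2_bracketE !simp.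
have he : 2%:R * (D h).1 0 i_e = - (2%:R * (D f).1 0 i_h).
  rewrite (coef _ _ _ _ _ (half_derivation_ef hD)) /=.
  by rewrite !sl2_bracketE !simp mulrN.
have hf : 2%:R * (D h).1 0 i_f = - (2%:R * (D e).1 0 i_h).
  rewrite (coef _ _ _ _ _ (half_derivation_ef hD)) /=.
  by rewrite !sl2_bracketE !simp mulrN.
have ef0 : (D e).1 0 i_f = 0.
  apply: (@natK_mul_eq0 5); transitivity (4%:R * (D e).1 0 i_f
    + 2%:R * (D e).1 0 i_f); [ring | by rewrite ef addNr].
have fe0 : (D f).1 0 i_e = 0.
  apply: (@natK_mul_eq0 5); transitivity (4%:R * (D f).1 0 i_e
    + 2%:R * (D f).1 0 i_e); [ring | by rewrite fe addNr].
have eh0 : (D e).1 0 i_h = 0.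
  apply: (@natK_mul_eq0 5); transitivity (2%:R * (4%:R * (D e).1 0 i_h)
    - 2%:R * (D e).1 0 i_h); [ring | rewrite eh mulrN hf; ring].
have fh0 : (D f).1 0 i_h = 0.
  apply: (@natK_mul_eq0 5); transitivity (2%:R * (4%:R * (D f).1 0 i_h)
    - 2%:R * (D f).1 0 i_h); [ring | rewrite fh mulrN he; ring].
have hf0 : (D h).1 0 i_f = 0.
  by apply/eqP; rewrite -oppr_eq0 -eh eh0 mulr0.
have he0 : (D h).1 0 i_e = 0.
  by apply/eqP; rewrite -oppr_eq0 -fh fh0 mulr0.
have eec : (D e).1 0 i_e = c.
  apply: (mulfI (natK_neq0 1)).
  rewrite -[RHS](addrK (2%:R * (D e).1 0 i_e)) -ee; ring.
have ffc : (D f).1 0 i_f = c.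
  apply: (mulfI (natK_neq0 1)).
  rewrite -[RHS](addKr (2%:R * (D f).1 0 i_f)) -ff; ring.
have Z a (s : 'rV[K]_3) i : (a *: s) 0 i = a * s 0 i by rewrite mxE.
by split; apply: sl2_rowP; rewrite Z !simp.
Qed.

(** * The component from sl2 to the radical *)

(** Eliminating the images of e and f from the three equations above leaves one
    equation on the x_j-coordinate of D h. Up to a common factor, m (m + 2) and
    8 are the values of the Casimir element on the radical and on the adjoint
    module, so D h can have a radical component only if the two modules are
    isomorphic. With w = 2 j - m, the elimination multiplies the
    equation of h by (2 + w) (2 - w) = 4 - w ^ 2, the terms in w ^ 2 then
    cancel, and so the weights w = 2 and w = -2, where that factor vanishes, are
    no exception. *)
Lemma half_derivation_rcoord_casimir D j : is_half_derivation D -> (j <= m)%N ->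
  (m%:R * (m%:R + 2%:R) - 8%:R) * rcoord (D h) j = 0.
Proof.
move=> hD jm.
have Eh := half_derivation_rcoord_h hD jm.
have Ee : (2%:R + ((2 * j)%:R - m%:R)) * rcoord_pred (D e) j
    = j%:R * (m%:R - j%:R + 1) * rcoord (D h) j.
  case: j jm {Eh} => [|j] jm /=; first by rewrite !mulr0 !mul0r.
  have := half_derivation_rcoord_e hD (ltnW jm).
  move: (rcoord _ j) (rcoord _ j.+1) => b a E.
  rewrite -[RHS](addrK (((2 * j)%:R - m%:R) * b)).
  have -> : m%:R - j.+1%:R + 1 = m%:R - j%:R :> K by rewrite -natr1; ring.
  rewrite -[RHS]addrAC -E; rewrite !natrM -!natr1; ring.
have Ef : j.+1%:R * (m%:R - j%:R)
      * ((2%:R - ((2 * j)%:R - m%:R)) * rcoord (D f) j.+1)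
    = - (j.+1%:R * (m%:R - j%:R) * rcoord (D h) j).
  have [->|jm'] := eqVneq j m; first by rewrite subrr !(mulr0, mul0r) oppr0.
  rewrite -mulrN; congr (_ * _).
  have := half_derivation_rcoord_f hD (_ : (j.+1 <= m)%N).
  rewrite ltn_neqAle jm' jm => /(_ isT) /=.
  move: (rcoord _ j) (rcoord _ j.+1) => a d E.
  rewrite -[RHS](addKr (((2 * j.+1)%:R - m%:R) * d)) -E.
  by rewrite !natrM -!natr1; ring.
move: Eh Ee Ef; move: (rcoord_pred _ _) (rcoord _ j) (rcoord _ j.+1) => b a d.
rewrite natrM -[j.+1%:R]natr1; move: (m%:R : K) (j%:R : K) => M J Eh Ee Ef.
pose w := 2%:R * J - M.
transitivity ((2%:R - w) * (2%:R + w) * (b - (J + 1) * (M - J) * d - 2%:R * a)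
  + (2%:R - w) * (J * (M - J + 1) * a - (2%:R + w) * b)
  + (2%:R + w) * ((J + 1) * (M - J) * ((2%:R - w) * d)
                  - - ((J + 1) * (M - J) * a))).
  by rewrite /w; ring.
by rewrite -Eh -Ee /w Ef !subrr !mulr0 !addr0.
Qed.

(** Once D h has no radical component, the equations of [h, e] and [f, h] kill the
    x_j-coordinate of D e unless its weight w = 2 j - m is -4, and that of D f
    unless w = 4. In these two cases the equation of [e, f] ties the coordinate to
    a coordinate of weight 0 of the other image, which is already known to be
    zero. *)
Lemma half_derivation_rcoord0 D j : is_half_derivation D -> m != 2 ->
  (j <= m)%N ->
  [/\ rcoord (D e) j = 0, rcoord (D f) j = 0 & rcoord (D h) j = 0].
Proof.
move=> hD m2; have Dh0 i : (i <= m)%N -> rcoord (D h) i = 0.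
  move=> im; have := half_derivation_rcoord_casimir hD im.
  have -> : m%:R * (m%:R + 2%:R) - 8%:R = (m + 4)%:R * (m%:R - 2%:R) :> K.
    by rewrite natrD; ring.
  by rewrite addnS -mulrA => /natK_mul_eq0 /(natK_sub_mul_eq0 m2).
have Dh0S i : rcoord (D h) i.+1 = 0.
  by case: (ltnP i m) => [/Dh0 //|mi]; rewrite rcoord_gt.
have Dh0P i : (i <= m)%N -> rcoord_pred (D h) i = 0.
  by case: i => //= i /ltnW/Dh0.
have De0 i : (i <= m)%N -> (i.*2 + 4)%N != m -> rcoord (D e) i = 0.
  move=> im /natK_sub_mul_eq0; apply.
  have := half_derivation_rcoord_e hD im; rewrite Dh0S mulr0 sub0r.
  by move/eqP; rewrite -addr_eq0 -mulrDl => /eqP <-; rewrite -muln2 natrD !natrM;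
    ring.
have Df0 i : (i <= m)%N -> i.*2 != (m + 4)%N -> rcoord (D f) i = 0.
  move=> im; rewrite eq_sym => /natK_sub_mul_eq0; apply.
  have := half_derivation_rcoord_f hD im; rewrite Dh0P // subr0.
  by move/eqP; rewrite -subr_eq0 -mulrBl => /eqP <-; rewrite -muln2 natrD !natrM;
    ring.
move=> jm; split; last exact: Dh0.
  have [jm4|/(De0 _ jm)//] := eqVneq (j.*2 + 4)%N m.
  have j2m : (j.+2 <= m)%N by lia.
  have := half_derivation_rcoord_h hD (ltnW j2m).
  rewrite Dh0 1?ltnW //= (Df0 _ j2m) ?mulr0 ?subr0 //; last by lia.
case: j jm => [|[|j]] jm; [by apply: Df0; lia .. |].
have [jm4|/(Df0 _ jm)//] := eqVneq (j.+2).*2 (m + 4)%N.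
have := half_derivation_rcoord_h hD (ltnW jm).
rewrite Dh0 1?ltnW //= De0; [|by lia..].
rewrite mulr0 sub0r => /esym/eqP; rewrite oppr_eq0 -mulrA => /eqP.
by move=> /natK_mul_eq0/natK_sub_mul_eq0; apply; lia.
Qed.

(** The only weights are -2, 0 and 2, so the factors 4 + w and 4 - w never vanish
    and the radical component of D h determines those of D e and D f. At the two
    extremal weights, where one of the two terms of the equation of [e, f] is
    missing, that equation then kills the coordinate of D h. *)
Lemma half_derivation_rcoord2 D : is_half_derivation D -> m = 2 ->
  forall j, (j <= m)%N ->
  [/\ rcoord (D e) j = rcoord (D h) 1 * (j == 0)%:R,
      rcoord (D f) j = - (2%:R^-1 * rcoord (D h) 1) * (j == 2)%:R
    & rcoord (D h) j = rcoord (D h) 1 * (j == 1)%:R].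
Proof.
move=> hD m2; have mR : m%:R = 2%:R :> K by rewrite m2.
have Ee j := half_derivation_rcoord_e (j := j) hD.
have Ef j := half_derivation_rcoord_f (j := j) hD.
have Eh j := half_derivation_rcoord_h (j := j) hD.
have le_m j : (j <= m)%N = (j <= 2)%N by rewrite m2.
rewrite mR in Ee Ef Eh.
have gt u : rcoord u 3 = 0 by rewrite rcoord_gt // m2.
have [le0 le1 le2] : [/\ (0 <= m)%N, (1 <= m)%N & (2 <= m)%N] by rewrite m2.
have := (Ee 0 le0, Ee 1 le1, Ee 2 le2, (Ef 0 le0, Ef 1 le1, Ef 2 le2),
         (Eh 0 le0, Eh 1 le1, Eh 2 le2)).
rewrite /= !gt {Ee Ef Eh}.
move: (rcoord (D e)) (rcoord (D f)) (rcoord (D h)) => b d a.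
move=> [[[[b0 b1] b2] [[d0 d1] d2]] [[a0 a1] a2]].
have nz : 2%:R != 0 :> K by rewrite natK_neq0.
have a0z : a 0 = 0.
  apply: (@natK_mul_eq0 2); transitivity (2%:R * (2%:R * a 0) - a 0).
    by ring.
  rewrite a0; transitivity (- (4%:R * d 1) - a 0); first by ring.
  by rewrite d1; ring.
have a2z : a 2 = 0.
  apply: (@natK_mul_eq0 5); transitivity (4%:R * (2%:R * a 2) - 2%:R * a 2).
    by ring.
  rewrite [2%:R * a 2 in X in X - _]a2.
  transitivity (4%:R * b 1 - 2%:R * a 2); first by ring.
  by rewrite b1; ring.
have b0E : b 0 = a 1.
  apply: (mulfI nz); transitivity (4%:R * b 0 - 2%:R * b 0); first by ring.
  by rewrite b0; ring.
have b1z : b 1 = 0 by apply: (@natK_mul_eq0 3); rewrite b1 a2z; ring.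
have b2z : b 2 = 0.
  apply: (@natK_mul_eq0 5); transitivity (4%:R * b 2 + 2%:R * b 2).
    by ring.
  by rewrite b2; ring.
have d0z : d 0 = 0.
  apply: (@natK_mul_eq0 5); transitivity (4%:R * d 0 + 2%:R * d 0).
    by ring.
  by rewrite d0; ring.
have d1z : d 1 = 0 by apply: (@natK_mul_eq0 3); rewrite d1 a0z; ring.
have d2E : d 2 = - (2%:R^-1 * a 1).
  rewrite -mulrN; apply: (mulfI nz); rewrite mulrA divff // mul1r.
  transitivity (4%:R * d 2 - 2%:R * d 2); first by ring.
  by rewrite d2; ring.
by move=> j; rewrite le_m; case: j => [|[|[|j]]] // _;
  rewrite ?(a0z, a2z, b0E, b1z, b2z, d0z, d1z, d2E) !(mulr0, mulr1).
Qed.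

(** * The action on the radical *)

Lemma lie_Lx_fst k u c (s : 'rV[K]_3) : u.1 = c *: s ->
  lie (x k) u = c *: lie (x k) (s, 0).
Proof.
have A0 : sl2_act m 0 = 0 :> 'M[K]_m.+1.
  by apply/matrixP=> i j; rewrite !mxE !(mul0r, addr0).
have Az : sl2_act m (c *: s) = c *: sl2_act m s.
  by rewrite -[c *: s]addr0 sl2_act_linear A0 addr0.
move=> us; congr pair; rewrite /= us; last first.
  by rewrite Az A0 !mulmx0 !subr0 scalemxAr.
by apply/rowP=> j; rewrite !mxE; ring.
Qed.

(** With D - c for the defect: 2 (D - c) [x_k, s] = [(D - c) x_k, s], because the
    radical is abelian and [x_k, D s] only sees the sl2-component c s of D s. *)
Lemma half_derivation_defect D c k s : is_half_derivation D ->
  (D (s, 0)).1 = c *: s ->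
  2%:R *: (- c *: lie (x k) (s, 0) + D (lie (x k) (s, 0)))
    = lie (- c *: x k + D (x k)) (s, 0).
Proof.
move=> hD Ds; rewrite lie_linearl scalerDr (half_derivation_double _ _ hD).
rewrite (lie_Lx_fst k Ds) addrCA addrC; congr (_ + _).
by rewrite scalerA -scalerDl; congr (_ *: _); ring.
Qed.

Lemma half_derivation_Lx D k : is_half_derivation D ->
  D (x k) = (D h).1 0 i_h *: x k.
Proof.
move=> hD; set c := _ 0 i_h.
have [_ Df Dh] := half_derivation_sl2_scalar hD.
pose y k := - c *: x k + D (x k).
suff : y k = 0.
  by move/(congr1 (+%R (c *: x k))); rewrite /y scaleNr addrA subrr add0r addr0.
elim: k => [|k IHk]; last first.
  have := half_derivation_defect k hD Df.
  have -> : lie (x k) (delta_mx 0 i_f, 0) = x k.+1 by apply: lie_xf.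
  rewrite -/(y k) -/(y k.+1) IHk.
  have -> : lie (0 : sl2r K m) (delta_mx 0 i_f, 0) = 0.
    have := lie_linearl (-1) (0 : sl2r K m) 0 (delta_mx 0 i_f, 0).
    by rewrite scaler0 addr0 scaleN1r addNr.
  by move/eqP; rewrite scaler_eq0 (negPf (natK_neq0 1)) => /eqP.
(* The defect at x_0 has twice the weight of x_0, that is 2 m up to sign; as
   2 m > m and 2 m > 2, no coordinate can have it. *)
have y0 : (2%:R * - m%:R) *: y 0 = lie (y 0) h.
  have := half_derivation_defect 0 hD Dh.
  have -> : lie (x 0) (delta_mx 0 i_h, 0) = - m%:R *: x 0.
    transitivity (((2 * 0)%:R - m%:R) *: x 0); first exact: lie_xh.
    by rewrite muln0 sub0r.
  move=> <-; have -> : D (- m%:R *: x 0) = - m%:R *: D (x 0) by exact: linearZ.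
  rewrite -[LHS]scalerA; congr (_ *: _); rewrite /y scalerDr; congr (_ + _).
  by rewrite !scalerA mulrC.
have Y i : (2%:R * - m%:R) * (y 0).1 0 i = (lie (y 0) h).1 0 i.
  by rewrite -sl2coordZ y0.
apply: sl2r_eqP => [| | |j jm].
- have := Y i_e; rewrite /= sl2_bracketE !simp => E.
  rewrite [RHS]mxE; apply: (@natK_sub_mul_eq0 m 1); first by lia.
  apply: (@natK_mul_eq0 1).
  transitivity (2%:R * - (y 0).1 0 i_e - 2%:R * - m%:R * (y 0).1 0 i_e).
    by ring.
  by rewrite E subrr.
- have := Y i_f; rewrite /= sl2_bracketE !simp => E.
  rewrite [RHS]mxE; apply: (@natK_mul_eq0 m); apply: (@natK_mul_eq0 1).
  transitivity (2%:R * (y 0).1 0 i_f - 2%:R * - m%:R * (y 0).1 0 i_f).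
    by rewrite -natr1; ring.
  by rewrite E subrr.
- have := Y i_h; rewrite /= sl2_bracketE !simp => E.
  rewrite [RHS]mxE; apply: (@natK_sub_mul_eq0 m 0); first by lia.
  apply: (@natK_mul_eq0 1); apply/eqP; rewrite -oppr_eq0 -E; apply/eqP; ring.
have := congr1 (fun u => rcoord u j) y0.
rewrite /= rcoordZ rcoord_lie //= !simp => E.
apply: (@natK_sub_mul_eq0 (2 * j + m) 0); first by lia.
transitivity (((2 * j)%:R - m%:R) * rcoord (y 0) j
  - 2%:R * - m%:R * rcoord (y 0) j); last by rewrite E subrr.
by rewrite natrD; ring.
Qed.

(** * Local half-derivations *)

(** For m = 2, with sl2 + radical identified with sl2 [t] / t ^ 2 through
    t e = x_0, t h = x_1, t f = - x_2 / 2, this is multiplication by c + mu t. *)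
Definition dual_number_action (T : sl2r K m -> sl2r K m) (c mu : K) : Prop :=
  [/\ T e = c *: e + mu *: x 0,
      T f = c *: f - (2%:R^-1 * mu) *: x 2,
      T h = c *: h + mu *: x 1
    & forall k, T (x k) = c *: x k].

Lemma half_derivation_shape D : is_half_derivation D ->
  exists c mu, dual_number_action D c mu.
Proof.
move=> hD; have [De Df Dh] := half_derivation_sl2_scalar hD.
set c := _ 0 i_h in De Df Dh.
have xfst (i : 'I_3) a k : (a *: x k).1 0 i = 0.
  by rewrite sl2coordZ sl2coord_Lx mulr0.
have crd (u : sl2r K m) a k (s : 'rV[K]_3) : (k <= m)%N -> u.1 = c *: s ->
    (forall j, (j <= m)%N -> rcoord u j = a * (j == k)%:R) ->
    u = c *: ((s, 0) : sl2r K m) + a *: x k.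
  move=> km us ur; apply: sl2r_eqP.
  - by rewrite sl2coordD xfst addr0 us.
  - by rewrite sl2coordD xfst addr0 us.
  - by rewrite sl2coordD xfst addr0 us.
  by move=> j jm; rewrite rcoordD !rcoordZ rcoord_sl2 rcoord_Lx // mulr0 add0r ur.
have [mu [Hf He Hh]] : exists mu, [/\
    forall j, (j <= m)%N -> rcoord (D f) j = - (2%:R^-1 * mu) * (j == 2)%:R,
    forall j, (j <= m)%N -> rcoord (D e) j = mu * (j == 0)%:R
  & forall j, (j <= m)%N -> rcoord (D h) j = mu * (j == 1)%:R].
  have [m2|m2] := eqVneq m 2.
    exists (rcoord (D h) 1).
    by split=> j /(half_derivation_rcoord2 hD m2) [].
  exists 0; split=> j /(half_derivation_rcoord0 hD m2) [De0 Df0 Dh0];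
  by rewrite ?(De0, Df0, Dh0) !(mulr0, mul0r, oppr0).
exists c, mu; split.
- exact: crd He.
- by rewrite -scaleNr; apply: crd Hf.
- by apply: crd Hh => //; apply: ltnW.
- by move=> k; apply: half_derivation_Lx.
Qed.

Lemma dual_number_action_sub T T' c c' mu mu' :
  dual_number_action T c mu -> dual_number_action T' c' mu' ->
  dual_number_action (fun u => T u - T' u) (c - c') (mu - mu').
Proof.
move=> [He Hf Hh Hx] [He' Hf' Hh' Hx']; split.
- by rewrite He He' !scalerBl opprD addrACA.
- by rewrite Hf Hf' mulrBr !scalerBl !opprD addrACA.
- by rewrite Hh Hh' !scalerBl opprD addrACA.
- by move=> k; rewrite Hx Hx' scalerBl.
Qed.

(** The vectors e, f, x_k are tested against a vector g with E g = 0: the shape of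
    E at g + u, compared along g, has scalar part zero, and what is left cannot
    match E u unless both vanish. The vector g is h, except for x_k with k positive, where e is used
    since the nilpotent part sends h to x_1 but e to x_0. *)
Lemma local_dual_number_action_eq0 (E : {linear sl2r K m -> sl2r K m}) :
  (forall u, exists T : {linear sl2r K m -> sl2r K m}, exists c mu,
     dual_number_action T c mu /\ E u = T u) ->
  E h = 0 -> forall u, E u = 0.
Proof.
move=> loc Eh.
have xsl2 (i : 'I_3) k : (x k).1 0 i = 0 by exact: sl2coord_Lx.
pose sl2coordE := (sl2coordD, sl2coordZ, sl2coord_basis, xsl2).
have scoord i u w : u = w -> u.1 0 i = w.1 0 i by move=> ->.
have erad j : rcoord e j = 0 by exact: rcoord_sl2.
have frad j : rcoord f j = 0 by exact: rcoord_sl2.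
have hrad j : rcoord h j = 0 by exact: rcoord_sl2.
have xrad k j : (k <= m)%N -> rcoord (x k) j = (j == k)%:R.
  exact: rcoord_Lx.
have m_ge1 := ltnW m_ge2.
pose rcoordE := (rcoordD, rcoordZ, erad, frad, hrad, xrad 0 _ isT,
  xrad 1 _ m_ge1, xrad 2 _ m_ge2).
have rcrd j u w : u = w -> rcoord u j = rcoord w j by move=> ->.
have Ee : E e = 0.
  have [T [c [mu [[Te _ _ _] ET]]]] := loc e.
  have [T' [c' [mu' [[Te' _ Th' _] ET']]]] := loc (e + h).
  have := ET'; rewrite !linearD Eh addr0 ET Te Te' Th' => eq.
  have := scoord i_h _ _ eq; rewrite !sl2coordE !simp => c'0.
  have := scoord i_e _ _ eq; rewrite !sl2coordE !simp => cc'.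
  have := rcrd 1 _ _ eq; rewrite !rcoordE /= !simp => mu'0.
  have := rcrd 0 _ _ eq; rewrite !rcoordE /= !simp => mumu'.
  by rewrite mumu' -mu'0 cc' -c'0 !scale0r addr0.
have Ef : E f = 0.
  have [T [c [mu [[_ Tf _ _] ET]]]] := loc f.
  have [T' [c' [mu' [[_ Tf' Th' _] ET']]]] := loc (f + h).
  have := ET'; rewrite !linearD Eh addr0 ET Tf Tf' Th' -!scaleNr => eq.
  have := scoord i_h _ _ eq; rewrite !sl2coordE !simp => c'0.
  have := scoord i_f _ _ eq; rewrite !sl2coordE !simp => cc'.
  have := rcrd 1 _ _ eq; rewrite !rcoordE /= !simp => mu'0.
  have := rcrd 2 _ _ eq; rewrite !rcoordE /= !simp => mumu'.
  by rewrite mumu' -mu'0 cc' -c'0 mulr0 oppr0 !scale0r addr0.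
have Ex k : (k <= m)%N -> E (x k) = 0.
  move=> km; have [T [c [mu [[_ _ _ Tx] ET]]]] := loc (x k).
  rewrite ET Tx; case: (posnP k) => [k0|k_gt0].
    have [T' [c' [mu' [[_ _ Th' Tx'] ET']]]] := loc (h + x k).
    have := ET'; rewrite !linearD Eh add0r ET Tx Th' Tx' => eq.
    have := scoord i_h _ _ eq; rewrite !sl2coordE !simp => c'0.
    have := rcrd k _ _ eq; rewrite !(rcoordE, xrad _ _ km) eqxx k0 /= !simp => ->.
    by rewrite -c'0 scale0r.
  have [T' [c' [mu' [[Te' _ _ Tx'] ET']]]] := loc (e + x k).
  have := ET'; rewrite !linearD Ee add0r ET Tx Te' Tx' => eq.
  have := scoord i_e _ _ eq; rewrite !sl2coordE !simp => c'0.
  have := rcrd k _ _ eq; rewrite !(rcoordE, xrad _ _ km) eqxx gtn_eqF //= !simp.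
  by move=> ->; rewrite -c'0 scale0r.
move=> u; rewrite (sl2r_basis u) !linearD !linearZ linear_sum /=.
rewrite -/e -/f -/h Ee Ef Eh !scaler0 !add0r big1 // => k _.
by rewrite linearZ /= Ex ?scaler0 // -ltnS.
Qed.

Lemma local_half_derivation_is_half_derivation
    (Delta : {linear sl2r K m -> sl2r K m}) :
  is_local_half_derivation Delta -> is_half_derivation Delta.
Proof.
move=> loc; have [D0 [hD0 E0]] := loc h.
suff eq0 u : (Delta \- D0) u = 0.
  have DE u : Delta u = D0 u by apply/eqP; rewrite -subr_eq0 [_ - _]eq0.
  by move=> u v; rewrite !DE.
move: u; apply: local_dual_number_action_eq0 => [u|]; last by rewrite /= E0 subrr.
have [D [hD ED]] := loc u; exists (D \- D0).
have [c [mu sD]] := half_derivation_shape hD.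
have [c0 [mu0 sD0]] := half_derivation_shape hD0.
exists (c - c0), (mu - mu0); split; first exact: dual_number_action_sub.
by rewrite /= ED.
Qed.

End HalfDerivations.

Theorem theorem22 (R : realType) (m : nat) (hm : (2 <= m)%N)
    (Delta : {linear sl2r (complex R) m -> sl2r (complex R) m}) :
  is_local_half_derivation Delta -> is_half_derivation Delta.
Proof.
by apply: local_half_derivation_is_half_derivation => //; apply: pchar_num.
Qed.
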